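(* Let $n\ge1$ be an integer and let $p\ge 1$. Then for every positive $u_0\in C^0(\mathbb{R}^n)$, any global positive classical solution $u\in C^0(\mathbb{R}^n\times[0,\infty))\cap C^{2,1}(\mathbb{R}^n\times(0,\infty))$ of $$u_t=u^p\Delta u\quad(x\in\mathbb{R}^n,\ t>0),\qquad u(x,0)=u_0(x)\quad(x\in\mathbb{R}^n)$$ has the property that for any $R>0$ we have $$\inf_{|x|<R}\left\{t^{\frac1p}u(x,t)\right\}\to+\infty\qquad\text{as } t\to\infty.$$
   Context: $C^{2,1}$ denotes functions twice continuously differentiable in $x$ and once in $t$. *)

(* Defs.v *)
From HB Require Import structures.
From mathcomp Require Import all_boot all_order all_algebra.
From mathcomp Require Import all_classical all_reals all_analysis.

Set Implicit Arguments.
Unset Strict Implicit.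
Unset Printing Implicit Defensive.

Import Order.TTheory GRing.Theory Num.Theory.
Import numFieldNormedType.Exports.

Local Open Scope classical_set_scope.
Local Open Scope ring_scope.

(* The library norm on 'rV[R]_n is the sup norm; its topology is the Euclidean
   one, but |x| in the mathematical statement is the Euclidean length. *)
Definition eucl_norm (R : realType) (n : nat) (x : 'rV[R]_n) : R :=
  Num.sqrt (\sum_(i < n) x 0 i ^+ 2).

Section SpaceTime.
Variables (R : realType) (n : nat).

Definition dirt : 'rV[R]_n * R := (0, 1).
Definition dirx (i : 'I_n) : 'rV[R]_n * R := (delta_mx 0 i, 0).

Definition laplacian (u : 'rV[R]_n * R -> R) (z : 'rV[R]_n * R) : R :=
  \sum_(i < n) 'D_(dirx i) ('D_(dirx i) u) z.

(* Meant for open Q: 'D_v is the limit of the two-sided difference quotient,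
   and 'D_v f z is unspecified where the limit does not exist, hence the
   separate derivability clauses. *)
Definition C21 (Q : set ('rV[R]_n * R)) (u : 'rV[R]_n * R -> R) : Prop :=
  [/\ {within Q, continuous u},
      (forall z, Q z -> derivable u z dirt) /\
        {within Q, continuous ('D_dirt u)},
      (forall i, (forall z, Q z -> derivable u z (dirx i)) /\
        {within Q, continuous ('D_(dirx i) u)}) &
      forall i j,
        (forall z, Q z -> derivable ('D_(dirx i) u) z (dirx j)) /\
        {within Q, continuous ('D_(dirx j) ('D_(dirx i) u))}].

(* The values of u at negative times are unconstrained. *)
Definition positive_classical_solution (p : R) (u0 : 'rV[R]_n -> R)
    (u : 'rV[R]_n * R -> R) : Prop :=
  [/\ {within [set z : 'rV[R]_n * R | 0 <= z.2], continuous u},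
      C21 [set z : 'rV[R]_n * R | 0 < z.2] u,
      forall x t, 0 <= t -> 0 < u (x, t),
      forall x t, 0 < t ->
        'D_dirt u (x, t) = u (x, t) `^ p * laplacian u (x, t) &
      forall x, u (x, 0) = u0 x].

End SpaceTime.

(* Main.v *)
Require Import Defs.
From mathcomp Require Import all_boot all_order all_algebra.
From mathcomp Require Import ring lra.
From mathcomp Require Import all_classical all_reals all_analysis.

Set Implicit Arguments.
Unset Strict Implicit.
Unset Printing Implicit Defensive.

Import Order.TTheory GRing.Theory Num.Theory.
Import numFieldNormedType.Exports.

Local Open Scope classical_set_scope.
Local Open Scope ring_scope.

(* For H > 0 and q large, compare u on the ball |x|^2 <= q with the separated
   subsolution (A + t)^(-1/p) H (1 - |x|^2 / q), which vanishes on the boundary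
   and lies below u_0 once A is large. Being a subsolution amounts to
   2 n H / q <= (1/p) w^(1-p) for w = H (1 - |x|^2 / q); as p >= 1 and w <= H,
   it suffices that 2 n p H^p <= q, and H remains arbitrary. On |x|^2 <= q / 2
   and for t >= A this yields t^(1/p) u >= H / 4. *)

(** * First- and second-order conditions at a minimum *)

(** Difference quotients at [b] from the left are nonpositive. Only this side is used, since a
    minimum in time may sit at the final time. *)
Lemma derive_left_min_le0 (R : realType) (f : R -> R) (a b : R) : a < b ->
  derivable f b 1 -> (forall t, t \in `]a, b[ -> f b <= f t) ->
  'D_1 f b <= 0.
Proof.
move=> ab df fmin.
have df' : h^-1 *: ((f \o shift b) (h *: 1) - f b) @[h --> 0^'] --> 'D_1 f b by [].
have {}df' := cvg_dnbhs_at_left df'.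
rewrite -(cvg_lim _ df')//; apply: limr_le.
  by apply/cvg_ex; eexists; exact: df'.
near=> h.
have h0 : h < 0 by near: h; exact: nbhs_left_lt.
have ha : a - b < h by near: h; apply: nbhs_left_gt; rewrite subr_lt0.
rewrite /= [h *: 1]mulr1 [_ *: _]/(_ * _) mulr_le0_ge0//.
  by rewrite invr_le0 ltW.
by rewrite subr_ge0 fmin// in_itv /=; lra.
Unshelve. all: by end_near. Qed.

Section DirectionalDerivative.
Variables (R : realType) (V : normedModType R).
Implicit Types (f : V -> R) (z v : V).

Lemma line_quotient f z v (s : R) :
  (fun h : R => h^-1 *: (((fun r : R => f (r *: v + z)) \o shift s) (h *: 1)
                         - f (s *: v + z))) =
  (fun h : R => h^-1 *: ((f \o shift (s *: v + z)) (h *: v)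
                         - f (s *: v + z))).
Proof.
apply/funext => h /=; congr (_ *: (f _ - _)).
by rewrite [h *: 1]mulr1 scalerDl addrA.
Qed.

Lemma is_derive_line f z v (s : R) : derivable f (s *: v + z) v ->
  is_derive s 1 (fun r : R => f (r *: v + z)) ('D_v f (s *: v + z)).
Proof.
move=> df; split; first by rewrite /derivable line_quotient.
by rewrite /derive line_quotient.
Qed.

(** Adding [b * h + k * h ^+ 2] to [f] along the line gives a function with a local minimum at 0,
    whose second derivative there cannot be negative. The free slope [b] absorbs the first-order
    part of a test function. *)
Lemma second_derive_ge f z v (b k d : R) : 0 < d ->
  (forall h : R, derivable f (h *: v + z) v) -> derivable ('D_v f) z v ->
  (forall h : R, `|h| < d -> f z - b * h - k * h ^+ 2 <= f (h *: v + z)) ->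
  - (2 * k) <= 'D_v ('D_v f) z.
Proof.
move=> d0 df ddf fge.
pose g (h : R) := f (h *: v + z) + (b * h + k * h ^+ 2).
pose G (h : R) := 'D_v f (h *: v + z) + (b + 2 * k * h).
have dg (h : R) : is_derive h 1 g (G h).
  apply: is_deriveD; first exact: is_derive_line.
  apply: is_derive_eq; rewrite /GRing.scale /=; ring.
have gmin (h : R) : `|h| < d -> g 0 <= g h.
  by move=> /fge; rewrite /g scale0r add0r; lra.
have G0 : G 0 = 0.
  have [_ <-] := dg 0.
  apply: (@derive_val _ _ _ _ _ _ _ (@derive1_at_min R g (- d) d 0 _ _ _ _)).
  - lra.
  - by move=> t _; have [] := dg t.
  - by rewrite in_itv /=; lra.
  - by move=> t; rewrite in_itv /= -ltr_norml; exact: gmin.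
have dG : is_derive (0 : R) 1 G ('D_v ('D_v f) z + 2 * k).
  have ddf0 : derivable ('D_v f) (0 *: v + z) v by rewrite scale0r add0r.
  have := is_derive_line ddf0; rewrite scale0r add0r => ?.
  apply: is_deriveD.
  by apply: is_derive_eq; rewrite /GRing.scale /=; ring.
(* If the second derivative of g at 0 were negative, G would be negative just
   to the right of 0 and g would decrease there. *)
rewrite leNgt; apply/negP => neg.
have [dG1 dG2] := dG.
have cG : h^-1 *: ((G \o shift 0) (h *: 1) - G 0) @[h --> 0^'] --> 'D_1 G 0 by [].
have lt0 : 'D_1 G 0 < 0 by rewrite dG2; lra.
have near0 := cvgr_lt _ cG _ lt0.
have [e /= e0 He] : exists2 e : R, 0 < e & forall h : R, 0 < h < e -> G h < 0.
  case: near0 => e /= e0 He; exists e => // h /andP[h0 he].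
  have := He h; rewrite /= sub0r normrN gtr0_norm// => /(_ he (lt0r_neq0 h0)).
  by rewrite G0 subr0 addr0 [h *: 1]mulr1 pmulr_rlt0// invr_gt0.
pose m := Num.min d e / 2.
have m0 : 0 < m by rewrite divr_gt0// lt_min d0.
have me : m < e by rewrite ltr_pdivrMr// gt_min; apply/orP; right; lra.
have md : m < d by rewrite ltr_pdivrMr// gt_min; apply/orP; left; lra.
have gc : {within `[0, m], continuous g}.
  apply: derivable_within_continuous => x _; by have [] := dg x.
have [c cm gE] := MVT m0 (fun x _ => dg x) gc.
move: cm; rewrite in_itv /= => /andP[c0 cm].
have : G c < 0 by apply: He; rewrite c0 (lt_trans cm).
have := gmin m; rewrite gtr0_norm// => /(_ md).
move: gE; rewrite subr0; nra.
Qed.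

End DirectionalDerivative.

(** * The squared Euclidean norm and compactness of its balls *)

Definition sqnorm (R : realType) (n : nat) (x : 'rV[R]_n) : R :=
  \sum_(i < n) x 0 i ^+ 2.

Section SquaredNorm.
Variables (R : realType) (n : nat).
Implicit Types x : 'rV[R]_n.

Lemma sqnorm_ge0 x : 0 <= sqnorm x.
Proof. by apply: sumr_ge0 => i _; exact: sqr_ge0. Qed.

Lemma sqnorm_continuous : continuous (@sqnorm R n).
Proof.
apply: continuous_big => [|i _ x]; first exact: add_continuous.
apply: (@continuous_comp _ _ _ (fun y : 'rV[R]_n => y 0 i) (fun r => r ^+ 2)).
  exact: coord_continuous.
exact: exprn_continuous.
Qed.

Lemma sqnorm_line x i (h : R) :
  sqnorm (h *: delta_mx 0 i + x) = sqnorm x + 2 * x 0 i * h + h ^+ 2.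
Proof.
rewrite /sqnorm (bigD1 i)//= [in RHS](bigD1 i)//= !mxE !eqxx mulr1.
rewrite (eq_bigr (fun j => x 0 j ^+ 2)); first ring.
by move=> j ji; rewrite !mxE (negPf ji) andbF mulr0 add0r.
Qed.

Lemma compact_sqnorm_le (q : R) : compact [set x : 'rV[R]_n | sqnorm x <= q].
Proof.
apply: bounded_closed_compact; last first.
  apply: (@preimage_closed _ _ (@sqnorm R n) [set y | y <= q]); last exact: closed_le.
  by move=> x _; exact: sqnorm_continuous.
(* [1 + q] bounds each coordinate without a square root: [a ^+ 2 <= q] forces |a| <= 1 + q. *)
exists (1 + q); split; first exact: num_real.
move=> M qM x /= xq.
have x1 i : `|x 0 i| <= M.
  have : x 0 i ^+ 2 <= q.
    apply: le_trans xq; rewrite /sqnorm (bigD1 i)//= lerDl.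
    by apply: sumr_ge0 => j _; exact: sqr_ge0.
  by rewrite ler_norml; nra.
have M0 : 0 <= M by have := sqnorm_ge0 x; lra.
rewrite [leLHS]/Num.Def.normr /= mx_normrE (bigmax_le _ M0)//= => -[j i] _.
by rewrite (ord1 j).
Qed.

End SquaredNorm.

(** * Comparison with the separated subsolution *)

(** Supplies the minimum needed in [barrier]; [0 < A] keeps the base of the power positive down to
    time 0. *)
Lemma scaled_continuous (R : realType) n (u : 'rV[R]_n * R -> R) (A e k q T : R) :
  0 < A -> {within [set w : 'rV[R]_n * R | 0 <= w.2], continuous u} ->
  {within [set x : 'rV[R]_n | sqnorm x <= q] `*` `[0, T],
    continuous (fun w => (A + w.2) `^ e * u w + k * sqnorm w.1)}.
Proof.
move=> A0 uc.
set K := _ `*` _.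
have {}uc : {within K, continuous u}.
  by apply: continuous_subspaceW uc => -[x t] [_] /=; rewrite in_itv => /andP[].
have sc : {within K, continuous (fun w : 'rV[R]_n * R => (A + w.2) `^ e)}.
  apply: continuous_in_subspaceT => -[x t]; rewrite inE => -[_] /=.
  rewrite in_itv /= => /andP[t0 _].
  have At : 0 < A + t by rewrite ltr_wpDr.
  apply: (@continuous_comp _ _ _ (fun w : 'rV[R]_n * R => A + w.2) (fun s => s `^ e)).
    by apply: cvgD; [exact: cvg_cst | exact: cvg_snd].
  apply/differentiable_continuous/derivable1_diffP.
  by have [] := is_derive1_powR e At.
have qc : {within K, continuous (fun w : 'rV[R]_n * R => k * sqnorm w.1)}.
  apply: continuous_subspaceT => w; apply: cvgM; first exact: cvg_cst.
  apply: (@continuous_comp _ _ _ fst (@sqnorm R n)); first exact: cvg_fst.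
  exact: sqnorm_continuous.
by move=> w; apply: cvgD; [apply: cvgM; [exact: sc | exact: uc] | exact: qc].
Qed.

(** The comparison is multiplied by (A + t)^(1/p), so that it reads [H <= z]. At a minimum point of
    [z] with value below [H], minimality in space bounds the Laplacian of [u] from below, minimality
    in time makes the time derivative nonpositive, and the equation turns the two into a
    contradiction with the size of [q]. *)
Lemma barrier (R : realType) n (p : R) u0 (u : 'rV[R]_n * R -> R) (A H q : R) :
  1 <= p -> positive_classical_solution p u0 u ->
  0 < A -> 0 < H -> 0 < q -> 2 * n%:R * p * H `^ p < q ->
  (forall x, sqnorm x <= q -> H < A `^ p^-1 * u (x, 0)) ->
  forall x t, 0 <= t -> sqnorm x <= q ->
  H <= (A + t) `^ p^-1 * u (x, t) + H / q * sqnorm x.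
Proof.
move=> hp hu A0 H0 q0 large_q init x t t0 xq; have [uc u21 u_pos u_eq _] := hu.
pose z (w : 'rV[R]_n * R) := (A + w.2) `^ p^-1 * u w + H / q * sqnorm w.1.
rewrite -[leRHS]/(z (x, t)).
have p0 : 0 < p by lra.
have K0 : [set x : 'rV[R]_n | sqnorm x <= q] `*` `[0, t] !=set0.
  by exists (x, t); split => //=; rewrite in_itv /= t0 lexx.
have Kc := compact_setX (@compact_sqnorm_le R n q) (@segment_compact R 0 t).
have [[y s]] := compact_EVT_min K0 Kc (scaled_continuous (e := p^-1) (k := H / q) (T := t) A0 uc).
rewrite inE => -[/= yq]; rewrite in_itv /= => /andP[s0 st] zmin.
have {}zmin y' s' : sqnorm y' <= q -> 0 <= s' -> s' <= t -> z (y, s) <= z (y', s').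
  move=> y'q s'0 s't; apply: zmin; rewrite inE; split => //=.
  by rewrite in_itv /= s'0.
rewrite leNgt; apply/negP => zH.
have {x t0 xq K0 Kc zH} zH : z (y, s) < H.
  by apply: le_lt_trans zH; exact: zmin.
have kp : 0 < H / q by exact: divr_gt0.
have As : 0 < A + s by lra.
have sig0 : 0 < (A + s) `^ p^-1 by rewrite powR_gt0.
have us0 : 0 < u (y, s) by exact: u_pos.
(* On the lateral boundary z < H would give u <= 0, and s = 0 is excluded by
   [init]; so (y, s) is an interior or final-time minimum. *)
have yq' : sqnorm y < q.
  rewrite -subr_gt0 -(pmulr_rgt0 _ kp) mulrBr divfK ?gt_eqF//.
  by move: zH; rewrite /z /=; have := mulr_gt0 sig0 us0; lra.
have {}s0 : 0 < s.
  rewrite lt_neqAle s0 andbT; apply/eqP => s00; move: zH.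
  rewrite /z -s00 addr0 /=.
  have := init _ yq; have := mulr_ge0 (ltW kp) (sqnorm_ge0 y); lra.
have suH : (A + s) `^ p^-1 * u (y, s) < H.
  by move: zH; rewrite /z /=; have := mulr_ge0 (ltW kp) (sqnorm_ge0 y); lra.
set sig := (A + s) `^ p^-1 in sig0 suH.
have [_ [udt _] udx uddx] := u21.
have lap : - (2 * (H / q / sig)) *+ n <= laplacian u (y, s).
  rewrite /laplacian -[leLHS](_ : \sum_(i < n) - (2 * (H / q / sig)) = _); last first.
    by rewrite sumr_const card_ord.
  apply: ler_sum => i _.
  have inQ (h : R) : 0 < (h *: dirx R i + (y, s)).2 by rewrite /= scaler0 add0r.
  (* For |h| < d <= 1, [sqnorm] grows by at most (2 |y_i| + 1) |h| < q - [sqnorm y], so the segment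
     stays in the ball. *)
  pose d := Num.min 1 ((q - sqnorm y) / (2 * `|y 0 i| + 1)).
  have y1 : 0 < 2 * `|y 0 i| + 1 by rewrite ltr_wpDl// mulr_ge0.
  have d0 : 0 < d by rewrite lt_min ltr01 divr_gt0// subr_gt0.
  (* The slope is the linear term of [sqnorm_line] times [H / q / sig]. *)
  apply: (@second_derive_ge _ _ _ _ _ (2 * (H / q / sig) * y 0 i) _ d d0).
  - by move=> h; apply: (udx i).1; exact: inQ.
  - by apply: (uddx i i).1.
  - move=> h; rewrite lt_min ltr_pdivlMr// => /andP[h1 hd].
    have lineE : h *: dirx R i + (y, s) = (h *: delta_mx 0 i + y, s).
      by congr pair; rewrite /= scaler0 add0r.
    have hq : sqnorm (h *: delta_mx 0 i + y) <= q.
      rewrite sqnorm_line.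
      have := ler_norm (y 0 i * h); rewrite normrM.
      have := normr_ge0 h; rewrite -(real_normK (num_real h)); nra.
    have := zmin _ _ hq (ltW s0) st; rewrite /z /= sqnorm_line lineE -/sig => zh.
    rewrite -(ler_pM2l sig0) !mulrBr.
    have -> : sig * (2 * (H / q / sig) * y 0 i * h) = H / q * (2 * y 0 i * h).
      by field; rewrite !gt_eqF.
    have -> : sig * (H / q / sig * h ^+ 2) = H / q * h ^+ 2.
      by field; rewrite !gt_eqF.
    move: zh; rewrite !mulrDr; lra.
have lineE r : r *: dirt R n + (y, 0) = (y, r).
  by congr pair; rewrite /= ?scaler0 ?add0r// addr0 [r *: 1]mulr1.
have udts : derivable u (s *: dirt R n + (y, 0)) (dirt R n).
  by rewrite lineE; exact: udt.
have := is_derive_line udts.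
rewrite lineE (_ : (fun r => _) = (fun r => u (y, r))); last first.
  by apply/funext => r; rewrite lineE.
move=> du.
have dpow : is_derive s 1 (fun r => (A + r) `^ p^-1) (p^-1 * (A + s) `^ (p^-1 - 1)).
  have dA : is_derive s 1 (fun r => A + r) 1.
    by rewrite -[X in is_derive _ _ _ X]add0r; exact: is_deriveD.
  have := is_derive1_comp (is_derive1_powR p^-1 As) dA.
  by rewrite mulr1.
have [dphi1 dphi2] := is_deriveM dpow du.
(* At fixed [y] the [sqnorm] term of [z] is constant in time and drops out. *)
have := derive_left_min_le0 s0 dphi1 _.
rewrite {}dphi2 => D0.
have {}D0 : sig * 'D_(dirt R n) u (y, s) + u (y, s) * (p^-1 * (A + s) `^ (p^-1 - 1)) <= 0.
  apply: D0 => r; rewrite in_itv /= => /andP[r0 rs].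
  have := zmin y r yq (ltW r0) (le_trans (ltW rs) st).
  by rewrite /z /= lerD2r.
have sigp : sig `^ p = A + s by rewrite /sig -powRrM mulVf ?gt_eqF// powRr1// ltW.
have pV0 : 0 < p^-1 by rewrite invr_gt0.
have sig1 : (A + s) * (A + s) `^ (p^-1 - 1) = sig by rewrite mulr_powRB1// ltW.
(* The left side is (sig u)^p = sig u (sig u)^(p-1); [p >= 1] makes the last factor monotone in sig
   u < H. *)
have sigu_pow : (A + s) * u (y, s) `^ p <= sig * u (y, s) * H `^ (p - 1).
  have v0 : 0 <= sig * u (y, s) by rewrite mulr_ge0 ?ltW.
  rewrite -sigp -powRM ?(ltW sig0) ?(ltW us0)// -(mulr_powRB1 v0 p0) ler_wpM2l//.
  by apply: ge0_ler_powR; rewrite ?nnegrE ?subr_ge0// ltW.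
(* The factor [A + s] turns (A + s)^(1/p - 1) into [sig], which is then cancelled. *)
move: D0; rewrite -(ler_pM2l As) mulr0 u_eq// => D0.
suff : q <= 2 * n%:R * p * H `^ p by rewrite leNgt large_q.
have upow := powR_gt0 p us0.
have HH := mulr_powRB1 (ltW H0) p0.
set L := laplacian u (y, s) in lap D0.
set P := (A + s) `^ (p^-1 - 1) in sig1 D0.
pose c := 2 * (H / q / sig) * n%:R.
have c0 : 0 <= c by rewrite mulr_ge0// mulr_ge0// divr_ge0 ?ltW.
have Lc : - c <= L by move: lap; rewrite -[X in X <= _]mulr_natr mulNr.
have {}D0 : (A + s) * u (y, s) `^ p * L + u (y, s) * p^-1 <= 0.
  rewrite -(pmulr_rle0 _ sig0); apply: le_trans D0.
  by rewrite -{2}sig1; nra.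
have : (A + s) * u (y, s) `^ p * L >= - (sig * u (y, s) * H `^ (p - 1) * c).
  apply: (@le_trans _ _ (- ((A + s) * u (y, s) `^ p * c))).
    by rewrite lerN2 ler_wpM2r.
  by rewrite -mulrN ler_wpM2l// mulr_ge0 ?ltW.
have -> : sig * u (y, s) * H `^ (p - 1) * c = u (y, s) * (2 * n%:R * H `^ p / q).
  by rewrite -HH /c; field; rewrite !gt_eqF.
(* Cancelling [u (y, s)] leaves 1/p <= 2 n H^p / q, against [large_q]. *)
move=> bound.
have : u (y, s) * p^-1 <= u (y, s) * (2 * n%:R * H `^ p / q) by lra.
by rewrite ler_pM2l// ler_pdivlMr// mulrC ler_pdivrMr// => /le_trans -> //; rewrite mulrAC.
Qed.

(** * Choice of the parameters and passage to large times *)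

Theorem proposition1p3 (R : realType) (n : nat) (p : R)
    (hn : (1 <= n)%N) (hp : 1 <= p)
    (u0 : 'rV[R]_n -> R) (u0_cont : continuous u0)
    (u0_pos : forall x, 0 < u0 x)
    (u : 'rV[R]_n * R -> R) (hu : positive_classical_solution p u0 u)
    (r : R) (hr : 0 < r) :
  inf [set t `^ p^-1 * u (x, t) | x in [set x : 'rV[R]_n | eucl_norm x < r]]
    @[t --> +oo] --> +oo.
Proof.
have [_ _ u_pos _ u_init] := hu.
have p0 : 0 < p by lra.
have pV0 : 0 < p^-1 by rewrite invr_gt0.
have pV1 : p^-1 <= 1 by rewrite invf_le1.
have sqnorm0 : sqnorm (0 : 'rV[R]_n) = 0.
  by rewrite /sqnorm big1// => i _; rewrite mxE expr0n.
(* Nonemptiness matters: [inf] of the empty set is 0 by default. *)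
have ball0 : [set x : 'rV[R]_n | eucl_norm x < r] !=set0.
  by exists 0; rewrite /= /eucl_norm -/(sqnorm 0) sqnorm0 sqrtr0.
apply/cvgryPge => B.
(* One factor 2 pays for the quadratic term on the half ball, the other for replacing [A + t] by
   [t]. *)
pose H := 4 * (`|B| + 1).
have H0 : 0 < H by have := normr_ge0 B; rewrite /H; lra.
have BH : 4 * B <= H by have := ler_norm B; rewrite /H; lra.
have Hp0 : 0 <= 2 * n%:R * p * H `^ p by rewrite !mulr_ge0 ?powR_ge0// ltW.
have r20 : 0 < r ^+ 2 by rewrite exprn_gt0.
(* The first summand puts the ball of radius [r] inside [sqnorm x <= q / 2]; the second gives
   [large_q]. *)
pose q := 2 * r ^+ 2 + 2 * n%:R * p * H `^ p.
have q0 : 0 < q by rewrite /q; lra.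
have large_q : 2 * n%:R * p * H `^ p < q by rewrite /q; lra.
have K0 : [set x : 'rV[R]_n | sqnorm x <= q] !=set0.
  by exists 0; rewrite /= sqnorm0 ltW.
have [c _ minc] := compact_EVT_min K0 (@compact_sqnorm_le R n q)
  (continuous_subspaceT u0_cont).
(* With [u0 c] the minimum of [u0] on the ball, A^(1/p) [u0 c] = H + [u0 c] > H. *)
pose A := (H / u0 c + 1) `^ p.
have Hc : 0 < H / u0 c by rewrite divr_gt0.
have A0 : 0 < A by rewrite powR_gt0// addr_gt0.
have AV : A `^ p^-1 = H / u0 c + 1.
  by rewrite /A -powRrM divff ?gt_eqF// powRr1// addr_ge0// ltW.
have init x : sqnorm x <= q -> H < A `^ p^-1 * u (x, 0).
  move=> xq; have := minc x; rewrite inE u_init AV => /(_ xq) cx.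
  apply: (@lt_le_trans _ _ ((H / u0 c + 1) * u0 c)).
    by rewrite mulrDl divfK ?gt_eqF// mul1r ltrDl.
  by rewrite ler_wpM2l// addr_ge0// ltW.
near=> t.
have At : A <= t by near: t; apply: nbhs_pinfty_ge; exact: num_real.
have t0 : 0 < t by lra.
apply: lb_le_inf; first exact: image_nonempty.
move=> _ [x /= xr <-].
have sqx : sqnorm x < r ^+ 2.
  by rewrite -(sqr_sqrtr (sqnorm_ge0 x)) ltr_pXn2r// ?nnegrE ?sqrtr_ge0// ltW.
have xq : sqnorm x <= q / 2 by rewrite /q; lra.
have xq1 : sqnorm x <= q by lra.
have := barrier hp hu A0 H0 q0 large_q init (ltW t0) xq1.
have half : H / q * sqnorm x <= H / 2.
  by rewrite mulrAC ler_pdivrMr//; nra.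
(* Here [A <= t], and 2^(1/p) <= 2 because 1/p <= 1. *)
have powt : (A + t) `^ p^-1 <= 2 * t `^ p^-1.
  apply: (@le_trans _ _ ((2 * t) `^ p^-1)).
    by apply: ge0_ler_powR; rewrite ?nnegrE; lra.
  rewrite powRM ?(ltW t0)// ler_wpM2r ?powR_ge0// ler1_powR//; lra.
have ux : 0 < u (x, t) by apply: u_pos; lra.
nra.
Unshelve. all: by end_near. Qed.
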